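(* Let $\sigma\in(0,1]$ and let $h:J\to\mathbb{R}^M$ be the fractal interpolation function described in the context, with $q_k\in\mathcal{HC}^{\sigma}(J)$ for each $k\in T$. Set $a_{\min}=\min\{|a_k|:k\in T\}$ and $\alpha_{\max}=\max\{|\alpha_k|:k\in T\}$. If $\dfrac{\alpha_{\max}}{a_{\min}^{\sigma}}<1$, then $h$ is H\''older continuous with exponent $\sigma$.
   Context: Setting: $M\ge 1$, $(x_i,\boldsymbol{y}_i)\in\mathbb{R}\times\mathbb{R}^M$ ($i=1,\dots,N$) are data points with $x_1<x_2<\dots<x_N$, $T=\{1,\dots,N-1\}$, $J=[x_1,x_N]$, $J_k=[x_k,x_{k+1}]$. For $k\in T$, $P_k(t)=a_kt+d_k$ is the affine map $J\to J_k$ with $P_k(x_1)=x_k$, $P_k(x_N)=x_{k+1}$; each $P_k$ is contractive (so $N\ge 3$). For $k\in T$, $\alpha_k\in(-1,1)$ and $q_k:J\to\mathbb{R}^M$ is continuous with $q_k(x_1)=\boldsymbol{y}_k-\alpha_k\boldsymbol{y}_1$, $q_k(x_N)=\boldsymbol{y}_{k+1}-\alpha_k\boldsymbol{y}_N$. With $W_k(t,\boldsymbol{z})=(P_k(t),\alpha_k\boldsymbol{z}+q_k(t))$, the IFS $\{J\times\mathbb{R}^M;W_1,\dots,W_{N-1}\}$ has a unique attractor, which is the graph of a continuous function $h:J\to\mathbb{R}^M$, the fractal interpolation function (FIF), satisfying $h(t)=\alpha_k h(P_k^{-1}(t))+q_k(P_k^{-1}(t))$ for $t\in J_k$, $k\in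 T$. $\mathcal{HC}^{\sigma}(J)$ is the set of $g:J\to\mathbb{R}^M$ that are H\''older continuous with exponent $\sigma$, i.e. $\sup_{t_1\ne t_2}\|g(t_1)-g(t_2)\|/|t_1-t_2|^{\sigma}<\infty$. *)

(* Defs.v *)
From HB Require Import structures.
From mathcomp Require Export all_boot all_order all_algebra.
From mathcomp Require Export all_classical all_reals all_analysis.
Export Order.TTheory GRing.Theory Num.Theory.
Export numFieldNormedType.Exports.

Set Implicit Arguments.
Unset Strict Implicit.
Unset Printing Implicit Defensive.

Local Open Scope classical_set_scope.
Local Open Scope ring_scope.

(* With n + 1 points indexed by 'I_n.+1 (from 0), the k-th of the n
   subintervals, k : 'I_n, has end points [left_pt k] and [right_pt k]. *)
Definition left_pt n (k : 'I_n) : 'I_n.+1 := widen_ord (leqnSn n) k.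
Definition right_pt n (k : 'I_n) : 'I_n.+1 := lift ord0 k.

(* The seed of the iterated min/max is one of the values, so that these are
   the minimum and the maximum of the finite nonempty set { |u k| }. *)
Definition min_abs (R : realType) n (u : 'I_n.+1 -> R) : R :=
  \big[Num.min/`|u ord0|]_(k < n.+1) `|u k|.
Definition max_abs (R : realType) n (u : 'I_n.+1 -> R) : R :=
  \big[Num.max/`|u ord0|]_(k < n.+1) `|u k|.

(* Functions on J are total functions on R of which only the values on J
   matter.  The norm of 'rV_M is the sup norm; as all norms of R^M are
   equivalent, Hoelder continuity does not depend on it. *)
Definition hoelder_continuous (R : realType) (M : nat) (J : set R) (sigma : R)
    (g : R -> 'rV[R]_M) : Prop :=
  has_ubound [set `|g t.1 - g t.2| / `|t.1 - t.2| `^ sigma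
             | t in [set t : R * R | [/\ J t.1, J t.2 & t.1 != t.2]]].

Definition is_attractor (X : topologicalType) (D : set X) (I : Type)
    (W : I -> X -> X) (A : set X) : Prop :=
  [/\ A `<=` D, A !=set0, compact A & A = \bigcup_(k in [set: I]) (W k @` A)].

Definition ifs_map (R : realType) (M n : nat) (a d alpha : 'I_n -> R)
    (q : 'I_n -> R -> 'rV[R]_M) (k : 'I_n) (p : R * 'rV[R]_M) :
    R * 'rV[R]_M :=
  (a k * p.1 + d k, alpha k *: p.2 + q k p.1).

Definition graph_on (R : realType) (M : nat) (J : set R) (h : R -> 'rV[R]_M) :
    set (R * 'rV[R]_M) :=
  [set (t, h t) | t in J].

(* The self-referential equation h (P_k t) = alpha_k h t + q_k t is the
   inclusion of the W_k-images of the graph of h in this graph. *)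
Definition is_fif (R : realType) (M n : nat) (J : set R)
    (a d alpha : 'I_n -> R) (q : 'I_n -> R -> 'rV[R]_M)
    (h : R -> 'rV[R]_M) : Prop :=
  {within J, continuous h} /\
  is_attractor (J `*` [set: 'rV[R]_M]) (ifs_map a d alpha q) (graph_on J h).

(* Main.v *)
Require Import Defs.
From mathcomp Require Import ring lra.
Local Open Scope classical_set_scope.
Local Open Scope ring_scope.

(** Write [P_k t = a_k t + d_k], [L = x_N - x_1] and [b = a_min^-sigma].  The
    invariance of the graph of [h] under the maps [W_k] says that
    [h (P_k t) = alpha_k h t + q_k t] on [J], so for two points of one cell
    [|h (P_k s) - h (P_k t)| <= alpha_max |h s - h t| + Q |s - t|^sigma]
    whereas [|s - t|^sigma <= b |P_k s - P_k t|^sigma].  Since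
    [alpha_max b < 1], iterating this inequality would give the Hoelder bound
    if pulling back by some [P_k] were always possible; this summation of a
    geometric series is [iterated_bound], where the boundedness of [h] and
    [alpha_max < 1] make the remainder vanish.

    Pulling back fails when a node separates the two points, and inserting
    that node at each stage would double the constant.  So the pairs
    [(x_1, t)] and [(s, x_N)] are treated first.  These two families are stable
    under pulling back by the first and by the last map respectively, unless
    the points are a whole cell apart, in which case the boundedness of [h] is
    enough ([far_bound]).  Pushing these estimates forward by the [P_k] gives
    the Hoelder estimate between a point and either node of its cell.  For a
    general pair [s <= t] there are then three cases: both points lie in one
    cell, and can be pulled back; they lie in adjacent cells, and are compared
    through the common node, without any recursion; or they are at least a
    cell apart. *)

(** * Minimum and maximum of absolute values *)

Lemma min_abs_le (R : realType) n (u : 'I_n.+1 -> R) k : min_abs u <= `|u k|.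
Proof. exact: bigmin_le. Qed.

Lemma min_abs_gt0 (R : realType) n (u : 'I_n.+1 -> R) :
  (forall k, u k != 0) -> 0 < min_abs u.
Proof. by move=> u0; apply: lt_bigmin => [|k _]; rewrite normr_gt0. Qed.

Lemma le_max_abs (R : realType) n (u : 'I_n.+1 -> R) k : `|u k| <= max_abs u.
Proof. exact: le_bigmax. Qed.

Lemma max_abs_lt (R : realType) n (u : 'I_n.+1 -> R) c :
  (forall k, `|u k| < c) -> max_abs u < c.
Proof. by move=> uc; apply: bigmax_lt. Qed.

(** * Hoelder continuity as an inequality *)

Lemma hoelder_continuousP (R : realType) (M : nat) (J : set R) (sigma : R)
    (g : R -> 'rV[R]_M) :
  hoelder_continuous J sigma g <->
  exists2 C, 0 <= C &
    forall s t, J s -> J t -> `|g s - g t| <= C * `|s - t| `^ sigma.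
Proof.
split=> [[C gC]|[C C0 gC]].
  exists `|C| => // s t Js Jt; have [->|st] := eqVneq s t.
    by rewrite subrr normr0 mulr_ge0 ?powR_ge0.
  have D0 : 0 < `|s - t| `^ sigma by rewrite powR_gt0 // normr_gt0 subr_eq0.
  rewrite -ler_pdivrMr //; apply: le_trans (ler_norm C).
  by apply: gC; exists (s, t).
exists C => _ [[s t] /= [Js Jt st] <-].
rewrite ler_pdivrMr; first exact: gC.
by rewrite powR_gt0 // normr_gt0 subr_eq0.
Qed.

(** Finitely many Hoelder continuous functions have a common constant. *)
Lemma hoelder_common_constant (R : realType) (M n : nat) (J : set R)
    (sigma : R) (q : 'I_n -> R -> 'rV[R]_M) :
  (forall k, hoelder_continuous J sigma (q k)) ->
  exists2 C, 0 <= C & forall k s t, J s -> J t ->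
    `|q k s - q k t| <= C * `|s - t| `^ sigma.
Proof.
move=> qH.
have /choice[C qC] : forall k, exists C, 0 <= C /\ forall s t, J s -> J t ->
    `|q k s - q k t| <= C * `|s - t| `^ sigma.
  by move=> k; have /hoelder_continuousP[C] := qH k; exists C.
exists (\sum_k C k); first by apply: sumr_ge0 => k _; case: (qC k).
move=> k s t Js Jt; apply: le_trans (proj2 (qC k) s t Js Jt) _.
rewrite ler_wpM2r ?powR_ge0 // (bigD1 k) //= lerDl.
by apply: sumr_ge0 => i _; case: (qC i).
Qed.

Lemma continuous_itv_bounded (R : realType) (M : nat) (l u : R)
    (h : R -> 'rV[R]_M) :
  {within `[l, u], continuous h} ->
  exists2 B, 0 <= B & forall t, [set` `[l, u]] t -> `|h t| <= B.
Proof.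
move=> hc.
have /compact_bounded[B [_ hB]] := continuous_compact hc (@segment_compact _ l u).
exists (`|B| + 1) => [|t Jt]; first by rewrite addr_ge0.
by apply: hB; [have := ler_norm B; lra | exists t].
Qed.

(** * Iteration of a contractive inequality *)

(** On the set [E], whenever [phi <= C * D] is not known at [p], the value
    [phi p] is controlled by the value at another point [p'] of [E], up to a
    multiple of [D p']. *)
Lemma iterated_bound (R : realType) (T : Type) (E : set T) (phi D : T -> R)
    (B C Q al b : R) :
  0 <= B -> 0 <= C -> 0 <= Q -> 0 <= b -> 0 <= al < 1 -> al * b < 1 ->
  (forall p, E p -> 0 <= D p) ->
  (forall p, E p -> phi p <= B) ->
  (forall p, E p -> phi p <= C * D p \/
    exists2 p', E p' & phi p <= al * phi p' + Q * D p' /\ D p' <= b * D p) ->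
  exists2 K, 0 <= K & forall p, E p -> phi p <= K * D p.
Proof.
move=> B0 C0 Q0 b0 /andP[al0 al1] alb D0 phiB step.
(* [K] is [C] plus the solution of [K = (al * K + Q) * b]. *)
pose K0 := Q * b / (1 - al * b).
have K00 : 0 <= K0 by rewrite divr_ge0 ?mulr_ge0 // subr_ge0 ltW.
have K0E : (al * K0 + Q) * b = K0 by rewrite /K0; field; lra.
have K0' : 0 <= C + K0 by rewrite addr_ge0.
have KE : (al * (C + K0) + Q) * b <= C + K0.
  have -> : (al * (C + K0) + Q) * b = (al * b) * C + K0 by rewrite -[in RHS]K0E; ring.
  by rewrite lerD2r ler_piMl // ltW.
exists (C + K0) => // p Ep.
have bnd m : forall p, E p -> phi p <= (C + K0) * D p + B * al ^+ m.
  elim: m => [|m IH] {Ep}p Ep.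
    by rewrite expr0 mulr1 (le_trans (phiB _ Ep)) // lerDr mulr_ge0 ?D0.
  have [phiC|[p' Ep' [phip' Dp']]] := step _ Ep.
    apply: le_trans phiC _; rewrite -[leLHS]addr0 lerD //.
      by rewrite ler_wpM2r ?D0 // lerDl.
    by rewrite mulr_ge0 ?exprn_ge0.
  apply: le_trans phip' _.
  apply: (@le_trans _ _ ((al * (C + K0) + Q) * D p' + B * al ^+ m.+1)).
    have := ler_wpM2l al0 (IH _ Ep'); rewrite exprS; lra.
  rewrite lerD2r; apply: (@le_trans _ _ ((al * (C + K0) + Q) * (b * D p))).
    by rewrite ler_wpM2l // addr_ge0 // mulr_ge0.
  by rewrite mulrA ler_wpM2r ?D0.
have cvgK : (C + K0) * D p + B * al ^+ m @[m --> \oo] --> (C + K0) * D p.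
  rewrite -[X in _ --> X]addr0; apply: cvgD; first exact: cvg_cst.
  by apply: cvg_geometric; rewrite ger0_norm.
by apply: (cvgr_to_ge cvgK); apply: nearW => m; apply: bnd.
Qed.

(** A bounded function satisfies a Hoelder estimate between points whose
    distance is bounded below. *)
Lemma far_bound (R : realType) (M : nat) (g : R -> 'rV[R]_M)
    (B e sigma s t : R) :
  0 < e -> 0 <= sigma -> 0 <= B -> `|g s| <= B -> `|g t| <= B ->
  e <= `|s - t| ->
  `|g s - g t| <= (B + B) / e `^ sigma * `|s - t| `^ sigma.
Proof.
move=> e0 sg B0 gs gt est.
apply: le_trans (ler_normB _ _) _; apply: le_trans (lerD gs gt) _.
rewrite -mulrA ler_peMr ?addr_ge0 // mulrC ler_pdivlMr ?powR_gt0 // mul1r.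
by rewrite ge0_ler_powR // nnegrE // ltW.
Qed.

(** * Affine maps and scaled vectors *)

Lemma affine_preimage (R : realType) (a d l u t : R) :
  0 < a -> a * l + d <= t <= a * u + d ->
  exists2 t', [set` `[l, u]] t' & t = a * t' + d.
Proof.
move=> a0 /andP[lt tu]; exists ((t - d) / a).
  by rewrite /= in_itv /= ler_pdivlMr // ler_pdivrMr //; apply/andP; split; lra.
by field; rewrite gt_eqF.
Qed.

Lemma affine_powR_le (R : realType) (a d m sigma s t : R) :
  0 < m -> m <= `|a| -> 0 <= sigma ->
  `|s - t| `^ sigma <= (m `^ sigma)^-1 * `|(a * s + d) - (a * t + d)| `^ sigma.
Proof.
move=> m0 ma sg; rewrite ler_pdivlMl ?powR_gt0 //.
rewrite -powRM ?(ltW m0) // ge0_ler_powR ?nnegrE ?mulr_ge0 ?(ltW m0) //.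
have -> : (a * s + d) - (a * t + d) = a * (s - t) by ring.
by rewrite normrM ler_wpM2r.
Qed.

Lemma scaled_difference_le (R : realType) (M : nat) (c al e : R)
    (v w p r : 'rV[R]_M) :
  `|c| <= al -> `|p - r| <= e ->
  `|(c *: v + p) - (c *: w + r)| <= al * `|v - w| + e.
Proof.
move=> cal pr; rewrite opprD addrACA -scalerBr.
apply: le_trans (ler_normD _ _) _; apply: lerD => //.
by rewrite normrZ ler_wpM2r.
Qed.

(** * Hoelder continuity of a self-referential function *)

(** The images [P k l, P k u] of the interval [J] are its cells.  They cover
    [J], the first starts at [l], the last ends at [u], and each cell that ends
    before [u] is followed by another one.  The function [h] has oscillation
    at most [B], satisfies a Hoelder estimate between points at least a cell
    apart, and contracts from [J] to each cell by the factor [al], up to a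
    Hoelder error.  The factor [b] bounds the loss incurred by pulling back a
    distance raised to the power [sigma]. *)
Lemma self_referential_bound (R : realType) (M n : nat) (l u : R)
    (a d : 'I_n.+1 -> R) (h : R -> 'rV[R]_M) (sigma al b B C Q : R) :
  let J := [set` `[l, u]] in let P := fun k t => a k * t + d k in
  0 <= sigma -> 0 <= al < 1 -> 0 <= b -> al * b < 1 ->
  0 <= B -> 0 <= C -> 0 <= Q -> l <= u ->
  (forall k, 0 < a k) ->
  P ord0 l = l -> P ord_max u = u ->
  (forall k t, t <= u -> P k u < t -> exists j, P j l = P k u) ->
  (forall s, J s -> exists k, exists2 s', J s' & s = P k s') ->
  (forall s t, J s -> J t -> `|h s - h t| <= B) ->
  (forall k s t, J s -> J t -> P k u - P k l <= `|s - t| ->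
    `|h s - h t| <= C * `|s - t| `^ sigma) ->
  (forall k s t, J s -> J t ->
    `|h (P k s) - h (P k t)| <= al * `|h s - h t| + Q * `|s - t| `^ sigma) ->
  (forall k s t, J s -> J t ->
    `|s - t| `^ sigma <= b * `|P k s - P k t| `^ sigma) ->
  exists2 K, 0 <= K & forall s t, J s -> J t ->
    `|h s - h t| <= K * `|s - t| `^ sigma.
Proof.
move=> J P sg al01 b0 alb B0 C0 Q0 lu a0 Pl Pu next cov hB far hP DP.
have al0 : 0 <= al by case/andP: al01.
have JE t : J t <-> l <= t <= u by rewrite /J /= in_itv.
have Jl : J l by apply/JE; rewrite lexx lu.
have Ju : J u by apply/JE; rewrite lexx lu.
have pre k t : P k l <= t <= P k u -> exists2 t', J t' & t = P k t'.
  exact: affine_preimage.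
pose phi (p : R * R) := `|h p.1 - h p.2|.
pose D (p : R * R) := `|p.1 - p.2| `^ sigma.
have D0 p : 0 <= D p by rewrite powR_ge0.
have iter (E : set (R * R)) C' : 0 <= C' -> E `<=` [set p | J p.1 /\ J p.2] ->
    (forall p, E p -> phi p <= C' * D p \/ exists k, exists2 p', E p' &
      p = (P k p'.1, P k p'.2)) ->
    exists2 K, 0 <= K & forall p, E p -> phi p <= K * D p.
  move=> C'0 EJ step.
  apply: (@iterated_bound _ _ E phi D B C' Q al b) => //.
    by move=> p /EJ[? ?]; apply: hB.
  move=> p Ep; have [|[k [p' Ep' ->]]] := step _ Ep; first by left.
  by right; exists p' => //; have [? ?] := EJ _ Ep'; split; [exact: hP|exact: DP].
have [K1 K10 hK1] : exists2 K, 0 <= K & forall t, J t ->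
    `|h l - h t| <= K * `|l - t| `^ sigma.
  have [||K K0 hK] := iter [set p | p.1 = l /\ J p.2] C C0; last first.
  - by exists K => // t Jt; apply: (hK (l, t)).
  - move=> [_ t] /= [-> Jt]; have /JE/andP[lt tu] := Jt.
    have [tP|Pt] := leP t (P ord0 u).
      right; exists ord0; have [|t' Jt' ->] := pre ord0 t; first by rewrite Pl lt.
      by exists (l, t'); rewrite //= Pl.
    left; apply: (far ord0) => //; rewrite /= Pl distrC ger0_norm; lra.
  - by move=> [s t] /= [-> Jt].
have [K2 K20 hK2] : exists2 K, 0 <= K & forall s, J s ->
    `|h s - h u| <= K * `|s - u| `^ sigma.
  have [||K K0 hK] := iter [set p | J p.1 /\ p.2 = u] C C0; last first.
  - by exists K => // s Js; apply: (hK (s, u)).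
  - move=> [s _] /= [Js ->]; have /JE/andP[ls su] := Js.
    have [Ps|sP] := leP (P ord_max l) s.
      right; exists ord_max; have [|s' Js' ->] := pre ord_max s; first by rewrite Pu Ps.
      by exists (s', u); rewrite //= Pu.
    left; apply: (far ord_max) => //; rewrite /= Pu distrC ger0_norm; lra.
  - by move=> [s t] /= [Js ->].
have push K k s t : 0 <= K -> J s -> J t ->
    `|h s - h t| <= K * `|s - t| `^ sigma ->
    `|h (P k s) - h (P k t)| <= (al * K + Q) * b * `|P k s - P k t| `^ sigma.
  move=> K0 Js Jt hst; apply: le_trans (hP _ _ _ Js Jt) _.
  apply: (@le_trans _ _ ((al * K + Q) * `|s - t| `^ sigma)).
    by rewrite mulrDl lerD2r -mulrA ler_wpM2l.
  by rewrite -[leRHS]mulrA ler_wpM2l ?DP // addr_ge0 ?mulr_ge0.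
pose C1 := (al * K1 + Q) * b; pose C2 := (al * K2 + Q) * b.
have C10 : 0 <= C1 by rewrite mulr_ge0 ?addr_ge0 ?mulr_ge0.
have C20 : 0 <= C2 by rewrite mulr_ge0 ?addr_ge0 ?mulr_ge0.
have [|||K K0 hK] := iter [set p | [/\ J p.1, J p.2 & p.1 <= p.2]] (C + (C2 + C1)).
- by rewrite !addr_ge0.
- by move=> p [].
- move=> [s t] /= [Js Jt st].
  have [k [s' Js' sE]] := cov _ Js.
  have /JE/andP[ls' s'u] := Js'; have /JE/andP[lt tu] := Jt.
  have [tP|Pt] := leP t (P k u).
    have Pst : P k l <= t.
      by apply: le_trans st; rewrite sE lerD2r ler_wpM2l // ltW.
    right; exists k; have [|t' Jt' tE] := pre k t; first by rewrite Pst.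
    exists (s', t'); last by rewrite sE tE.
    by split=> //=; move: st; rewrite sE tE lerD2r ler_pM2l.
  left; have [j jk] := next _ _ tu Pt.
  have sP : s <= P k u by rewrite sE lerD2r ler_wpM2l // ltW.
  rewrite /phi /D /= mulrDl.
  have [Ptj|tPj] := ltP (P j u) t.
    (* the cell of index [j] lies between [s] and [t] *)
    apply: (@le_trans _ _ (C * `|s - t| `^ sigma)).
      by apply: (far j) => //; rewrite jk distrC ger0_norm; lra.
    by rewrite lerDl mulr_ge0 ?powR_ge0 ?addr_ge0.
  (* [P k u = P j l] is the node between the cells of [s] and [t] *)
  have [|t' Jt' tE] := pre j t; first by rewrite jk (ltW Pt).
  have le1 : `|h s - h (P k u)| <= C2 * `|s - t| `^ sigma.
    rewrite {1}sE; apply: le_trans (push K2 k s' u K20 Js' Ju (hK2 _ Js')) _.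
    rewrite -sE ler_wpM2l // ge0_ler_powR ?nnegrE //.
    by rewrite !(distrC s) !ger0_norm; lra.
  have le2 : `|h (P k u) - h t| <= C1 * `|s - t| `^ sigma.
    rewrite -jk {1}tE; apply: le_trans (push K1 j l t' K10 Jl Jt' (hK1 _ Jt')) _.
    rewrite -tE jk ler_wpM2l // ge0_ler_powR ?nnegrE //.
    by rewrite !(distrC _ t) !ger0_norm; lra.
  have := ler_distD (h (P k u)) (h s) (h t).
  have : 0 <= C * `|s - t| `^ sigma by rewrite mulr_ge0 ?powR_ge0.
  rewrite mulrDl; lra.
exists K => // s t Js Jt; have [st|ts] := leP s t; first exact: (hK (s, t)).
by rewrite distrC (distrC s); apply: (hK (t, s)); split=> //; apply: ltW.
Qed.

(** * Fractal interpolation functions *)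

(** The graph of [h] is mapped into itself by each [W_k]. *)
Lemma fif_equation (R : realType) (M n : nat) (J : set R)
    (a d alpha : 'I_n -> R) (q : 'I_n -> R -> 'rV[R]_M) (h : R -> 'rV[R]_M) :
  is_fif J a d alpha q h ->
  forall k t, J t -> h (a k * t + d k) = alpha k *: h t + q k t.
Proof.
move=> [_ [_ _ _ grE]] k t Jt.
have : graph_on J h (ifs_map a d alpha q k (t, h t)).
  by rewrite grE; exists k => //; exists (t, h t) => //; exists t.
by move=> [s _ [-> <-]].
Qed.

(** The images of the graph of [h] cover it; projecting to the first coordinate,
    the cells cover [J]. *)
Lemma fif_cover (R : realType) (M n : nat) (J : set R)
    (a d alpha : 'I_n -> R) (q : 'I_n -> R -> 'rV[R]_M) (h : R -> 'rV[R]_M) :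
  is_fif J a d alpha q h ->
  forall s, J s -> exists k, exists2 s', J s' & s = a k * s' + d k.
Proof.
move=> [_ [_ _ _ grE]] s Js.
have : graph_on J h (s, h s) by exists s.
by rewrite grE => -[k _ [_ [s' Js' <-] [<- _]]]; exists k, s'.
Qed.

(* N = n + 2 data points, T = 'I_n.+1, J = [x_1, x_N] *)
Theorem theorem3p16 (R : realType) (M n : nat)
  (hM : (1 <= M)%N) (hN : (3 <= n.+2)%N)
  (x : 'I_n.+2 -> R) (y : 'I_n.+2 -> 'rV[R]_M)
  (hx : forall i j : 'I_n.+2, (i < j)%N -> x i < x j)
  (a d : 'I_n.+1 -> R)
  (hP1 : forall k, a k * x ord0 + d k = x (left_pt k))
  (hPN : forall k, a k * x ord_max + d k = x (right_pt k))
  (alpha : 'I_n.+1 -> R)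
  (halpha : forall k, -1 < alpha k < 1)
  (q : 'I_n.+1 -> R -> 'rV[R]_M)
  (hqc : forall k, {within `[x ord0, x ord_max], continuous (q k)})
  (hq1 : forall k, q k (x ord0) = y (left_pt k) - alpha k *: y ord0)
  (hqN : forall k, q k (x ord_max) = y (right_pt k) - alpha k *: y ord_max)
  (h : R -> 'rV[R]_M)
  (hh : is_fif `[x ord0, x ord_max] a d alpha q h)
  (sigma : R) (hsigma : 0 < sigma <= 1)
  (hqH : forall k, hoelder_continuous `[x ord0, x ord_max] sigma (q k))
  (hlt : max_abs alpha / min_abs a `^ sigma < 1) :
  hoelder_continuous `[x ord0, x ord_max] sigma h.
Proof.
have [sg0 _] := andP hsigma; have sg := ltW sg0.
set l := x ord0 in hP1 hqc hq1 hh hqH *.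
set u := x ord_max in hPN hqc hqN hh hqH *.
have lu : l < u by apply: hx.
have lr k : x (left_pt k) < x (right_pt k) by apply: hx; rewrite /= /bump leq0n.
have aE k : a k * (u - l) = x (right_pt k) - x (left_pt k).
  by rewrite -hP1 -hPN; ring.
have a0 k : 0 < a k.
  by rewrite -(pmulr_lgt0 _ (_ : 0 < u - l)) ?subr_gt0 // aE subr_gt0.
have m0 : 0 < min_abs a by apply: min_abs_gt0 => k; rewrite gt_eqF.
have ms0 : 0 < min_abs a `^ sigma by rewrite powR_gt0.
have [B B0 hB] := continuous_itv_bounded _ _ _ _ _ hh.1.
have [Q Q0 hQ] := hoelder_common_constant _ _ _ _ _ _ hqH.
have eqn := fif_equation _ _ _ _ _ _ _ _ _ hh.
pose e := min_abs a * (u - l).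
have e0 : 0 < e by rewrite mulr_gt0 // subr_gt0.
apply/hoelder_continuousP.
apply: (@self_referential_bound _ _ n l u a d h sigma (max_abs alpha)
  (min_abs a `^ sigma)^-1 (B + B) ((B + B) / e `^ sigma) Q) => //.
- rewrite (le_trans (normr_ge0 _) (le_max_abs _ _ alpha ord0)) /=.
  by apply: max_abs_lt => k; rewrite ltr_norml.
- by rewrite invr_ge0 ltW.
- by rewrite addr_ge0.
- by rewrite divr_ge0 ?addr_ge0 ?powR_ge0.
- exact: ltW.
- by rewrite hP1; congr x; apply: val_inj.
- by rewrite hPN; congr x; apply: val_inj.
- (* a cell whose right end is below [x_N] is not the last one *)
  move=> k t tu; rewrite hPN => xt.
  have kn : (k.+1 < n.+1)%N.
    rewrite ltnNge; apply/negP => nk.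
    have : right_pt k = ord_max.
      apply: val_inj; rewrite /= /bump leq0n add1n.
      by apply/eqP; rewrite eqn_leq nk ltn_ord.
    by move=> kE; move: xt; rewrite kE ltNge tu.
  by exists (Ordinal kn); rewrite hP1; congr x; apply: val_inj.
- exact: (fif_cover _ _ _ _ _ _ _ _ _ hh).
- by move=> s t Js Jt; apply: le_trans (ler_normB _ _) _; rewrite lerD ?hB.
- move=> k s t Js Jt st; apply: far_bound; rewrite ?hB //.
  apply: le_trans st; rewrite hP1 hPN -aE ler_wpM2r ?subr_ge0 ?(ltW lu) //.
  by rewrite -[leRHS](gtr0_norm (a0 k)) min_abs_le.
- move=> k s t Js Jt; rewrite !eqn //; apply: scaled_difference_le; last exact: hQ.
  exact: le_max_abs.
- by move=> k s t _ _; apply: affine_powR_le => //; apply: min_abs_le.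
Qed.
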